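(* Let $L>2$ and $r\geq 1$ be integers, let $\alpha_t,w_t\in\mathbb{C}$, $t=1,\dots,r$, be given constants, and let $B_L\in\mathbb{C}^{2^L\times2^L}$ be the circulant matrix whose first column has the entries $$(B_L)_j=\alpha_1w_1^j+\dots+\alpha_rw_r^j,\qquad j=0,\dots,2^L-1.$$ Then $B_L$ admits an explicit QTT representation with the ranks $(2,r+1,r+1,\dots,r+1)$: $$B_L=Q_1\Join Q_2\Join\dots\Join Q_L,$$ where $$Q_1=\begin{bmatrix}I&H\end{bmatrix},\qquad Q_2=\begin{bmatrix}I&K_{1,2}&\cdots&K_{r,2}\\0&M_{1,2}&\cdots&M_{r,2}\end{bmatrix},$$ $$Q_k=\begin{bmatrix}I&K_{1,k}&\cdots&K_{r,k}\\&M_{1,k}&&\\&&\ddots&\\&&&M_{r,k}\end{bmatrix},\quad k=3,\dots,L-1,$$ $$Q_L=\begin{bmatrix}\left(\sum_t\alpha_t\right)I+\left(\sum_t\alpha_tw_t\right)J'+\left(\sum_t\alpha_tw_t^{2^L-1}\right)J\\\alpha_1w_1M_{1,L}\\\vdots\\\alpha_rw_rM_{r,L}\end{bmatrix},$$ and where, for all $t=1,\dots,r$ and $k=1,\dots,L$, $$K_{t,k}=J'+q_{t,k}^{2^k-2}J,\qquad M_{t,k}=q_{t,k}I+q_{t,k}^2J'+J,\qquad q_{t,k}=w_t^{2^{L-k}}.$$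
   Context: Blocks: $I=\begin{bmatrix}1&0\\0&1\end{bmatrix}$, $J=\begin{bmatrix}0&1\\0&0\end{bmatrix}$, $J'=\begin{bmatrix}0&0\\1&0\end{bmatrix}$, $H=J+J'=\begin{bmatrix}0&1\\1&0\end{bmatrix}$. Blank entries in block matrices are zero $2\times2$ blocks. A circulant with first column $(c_0,\dots,c_{N-1})^\top$ has entries $c_{(i-j)\bmod N}$, $0\le i,j\le N-1$. The convention $0^0=1$ is used. Strong Kronecker product: if $X$ is a $p\times q$ block matrix with blocks $X_{\alpha\gamma}$ and $Y$ is a $q\times r$ block matrix with blocks $Y_{\gamma\beta}$ (all blocks of $X$ of one common size, all blocks of $Y$ of one common size), then $X\Join Y$ is the $p\times r$ block matrix with blocks $(X\Join Y)_{\alpha\beta}=\sum_{\gamma=1}^qX_{\alpha\gamma}\otimes Y_{\gamma\beta}$, where $\otimes$ is the Kronecker product. A QTT representation of a $2^L\times2^L$ matrix with ranks $(r_1,\dots,r_{L-1})$ is a factorization $Q_1\Join\dots\Join Q_L$ in which $Q_k$ is an $r_{k-1}\times r_k$ block matrix with $2\times2$ blocks, with $r_0=r_L=1$. *)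

(* Defs.v *)
From HB Require Import structures.
From mathcomp Require Import all_boot all_order all_algebra.
From mathcomp Require Import reals complex mxtens.

Set Implicit Arguments.
Unset Strict Implicit.
Unset Printing Implicit Defensive.

Import GRing.Theory.
Local Open Scope ring_scope.

(* A p x q block matrix with m x n blocks over R is an element of
   'M['M[R]_(m, n)]_(p, q). *)

Section StrongKronecker.
Variable R : comNzRingType.

Definition strong_kron p q r m n m' n'
    (X : 'M['M[R]_(m, n)]_(p, q)) (Y : 'M['M[R]_(m', n')]_(q, r)) :
    'M['M[R]_(m * m', n * n')]_(p, r) :=
  \matrix_(a, b) \sum_(g < q) tensmx (X a g) (Y g b).

(* Q 1 ⋈ Q 2 ⋈ ... ⋈ Q n, with Q k of size rk (k - 1) x rk k; Q 0 is a dummy.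
   The empty product is the identity with 1 x 1 blocks, which is neutral for
   the strong Kronecker product. The cast identifies 2 ^ n * 2 with 2 ^ n.+1. *)
Fixpoint strong_prod (rk : nat -> nat)
    (Q : forall k, 'M['M[R]_2]_(rk k.-1, rk k)) (n : nat) :
    'M['M[R]_(2 ^ n)]_(rk 0%N, rk n) :=
  match n with
  | 0 => 1%:M
  | n'.+1 =>
    map_mx (castmx (esym (expnSr 2 n'), esym (expnSr 2 n')))
           (strong_kron (strong_prod Q n') (Q n'.+1))
  end.

End StrongKronecker.

(* Equality of matrices whose dimensions are equal, but maybe not convertible. *)
Definition same_mx (T : Type) m n m' n'
    (A : 'M[T]_(m, n)) (B : 'M[T]_(m', n')) : Prop :=
  exists e : (m = m') * (n = n'), castmx e A = B.

(* For s = [:: r_1; ...; r_(L-1)], this is r_k for k = 0, ..., L, with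
   r_0 = r_L = 1 (r_L is the default value of nth). *)
Definition qtt_rank (s : seq nat) (k : nat) : nat := nth 1%N (1%N :: s) k.

Definition qtt_rep (R : comNzRingType) (L : nat) (s : seq nat)
    (A : 'M[R]_(2 ^ L))
    (Q : forall k, 'M['M[R]_2]_(qtt_rank s k.-1, qtt_rank s k)) : Prop :=
  size s = L.-1 /\
  same_mx (strong_prod Q L) (const_mx A : 'M['M[R]_(2 ^ L)]_1).

Section Blocks.
Variable R : comNzRingType.

(* Since j < N, the truncated subtraction i + N - j is exact. *)
Definition circulant N (c : nat -> R) : 'M[R]_N :=
  \matrix_(i, j) c ((i + N - j) %% N)%N.

Definition bI : 'M[R]_2 := 1%:M.
Definition bJ : 'M[R]_2 := delta_mx 0 1.
Definition bJ' : 'M[R]_2 := delta_mx 1 0.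
Definition bH : 'M[R]_2 := bJ + bJ'.

Variables (L r : nat) (alpha w : 'I_r -> R).

Definition qnode (t : 'I_r) (k : nat) : R := w t ^+ (2 ^ (L - k))%N.

Definition bK (t : 'I_r) (k : nat) : 'M[R]_2 :=
  bJ' + qnode t k ^+ (2 ^ k - 2)%N *: bJ.

Definition bM (t : 'I_r) (k : nat) : 'M[R]_2 :=
  qnode t k *: bI + qnode t k ^+ 2 *: bJ' + bJ.

Definition core_first : 'M['M[R]_2]_(1, 1 + 1) :=
  row_mx (const_mx bI) (const_mx bH).

Definition core_second : 'M['M[R]_2]_(1 + 1, 1 + r) :=
  block_mx (const_mx bI) (\row_t bK t 2)
           (const_mx 0)  (\row_t bM t 2).

Definition core_mid (k : nat) : 'M['M[R]_2]_(1 + r, 1 + r) :=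
  block_mx (const_mx bI) (\row_t bK t k)
           (const_mx 0)  (diag_mx (\row_t bM t k)).

Definition core_last : 'M['M[R]_2]_(1 + r, 1) :=
  col_mx (const_mx ((\sum_t alpha t) *: bI
                    + (\sum_t alpha t * w t) *: bJ'
                    + (\sum_t alpha t * w t ^+ (2 ^ L - 1)%N) *: bJ))
         (\col_t ((alpha t * w t) *: bM t L)).

End Blocks.

(* Main.v *)
(** The partial products are explicit: for 2 <= k < L, Q_1 ⋈ ... ⋈ Q_k is the
    block row [I, C_(1,k), ..., C_(r,k)], where C_(t,k) is the circulant of size
    2^k with first column 0, 1, q, q^2, ..., q^(2^k - 2) for q = q_(t,k).
    Writing indices as 2a + i and 2b + j, the entry of a circulant at shift
    2 (a - b) + (i - j) comes from I ⊗ (2 x 2 block) when a = b and from a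
    circulant of half the size tensored with a 2 x 2 block otherwise; since
    q_(t,k) = q_(t,k+1)^2 this gives
    I ⊗ K_(t,k+1) + C_(t,k) ⊗ M_(t,k+1) = C_(t,k+1), and the last core is the
    same identity for the circulants of alpha_t w_t^j, summed over t. *)
Require Import Defs.
From HB Require Import structures.
From mathcomp Require Import all_boot all_order all_algebra.
From mathcomp Require Import reals complex mxtens zify ring.

Set Implicit Arguments.
Unset Strict Implicit.
Unset Printing Implicit Defensive.

Import GRing.Theory.
Local Open Scope ring_scope.

Lemma same_mx_refl {T : Type} {m n} (A : 'M[T]_(m, n)) : same_mx A A.
Proof. by exists (erefl, erefl); rewrite castmx_id. Qed.

(** The cores have dimensions such as [1 + r], the factors have dimensions read off the list of
    ranks. [conform_mx] transports the former to the latter; its default is irrelevant once the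
    dimensions agree. *)
Lemma same_conform_mx {T : Type} {m n m' n'}
    (B : 'M[T]_(m', n')) (A : 'M[T]_(m, n)) :
  m = m' -> n = n' -> same_mx (conform_mx B A) A.
Proof.
by move=> em en; case: _ / em in B *; case: _ / en in B *;
  rewrite conform_mx_id; exact: same_mx_refl.
Qed.

Lemma eq_modn_small x e d N : x = (e * N + d)%N -> (d < N)%N -> d = (x %% N)%N.
Proof. by move=> -> dN; rewrite modnMDl modn_small. Qed.

(** Modulo N, a - b has a nonzero residue d + 1. Hence the shifts 2 (d + 1) - 1, 2 (d + 1) and 2 (d
    + 1) + 1 stay in [1, 2 N) and do not wrap around. *)
Lemma circulant_shift_neq N a b : (a < N)%N -> (b < N)%N -> a <> b ->
  exists e d, (a + N - b)%N = (e * N + d.+1)%N /\ (d.+1 < N)%N.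
Proof.
move=> aN bN ab; have [ba|ba] := ltnP b a; first by exists 1, (a - b).-1; lia.
by exists 0, (a + N - b).-1; lia.
Qed.

Section Blocks.
Variable R : comNzRingType.

Definition dkron {n} (A : 'M[R]_(2 ^ n)) (B : 'M[R]_2) : 'M[R]_(2 ^ n.+1) :=
  castmx (esym (expnSr 2 n), esym (expnSr 2 n)) (tensmx A B).

Definition block_prod {n p q r} (X : 'M['M[R]_(2 ^ n)]_(p, q))
    (Y : 'M['M[R]_2]_(q, r)) : 'M['M[R]_(2 ^ n.+1)]_(p, r) :=
  \matrix_(a, b) \sum_(g < q) dkron (X a g) (Y g b).

Definition qubit_index {n} (a : 'I_(2 ^ n)) (i : 'I_2) : 'I_(2 ^ n.+1) :=
  cast_ord (esym (expnSr 2 n)) (mxtens_index (a, i)).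

Lemma qubit_indexP n (x : 'I_(2 ^ n.+1)) : exists a i, x = qubit_index a i.
Proof.
pose y := cast_ord (expnSr 2 n) x.
exists (mxtens_unindex y).1, (mxtens_unindex y).2.
by rewrite /qubit_index -surjective_pairing mxtens_unindexK cast_ordK.
Qed.

Lemma dkronE n (A : 'M_(2 ^ n)) B a b i j :
  dkron A B (qubit_index a i) (qubit_index b j) = A a b * B i j.
Proof. by rewrite castmxE /= !esymK !cast_ordKV tensmxE. Qed.

Lemma dkronDr n (A : 'M_(2 ^ n)) B C :
  dkron A (B + C) = dkron A B + dkron A C.
Proof.
apply/matrixP => x y.
have [a [i ->]] := qubit_indexP x; have [b [j ->]] := qubit_indexP y.
by rewrite mxE !dkronE mxE mulrDr.
Qed.

Lemma dkronr0 n (A : 'M_(2 ^ n)) : dkron A 0 = 0.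
Proof. by apply: (addrI (dkron A 0)); rewrite -dkronDr !addr0. Qed.

Lemma dkron_sumr n (A : 'M_(2 ^ n)) I (s : seq I) (F : I -> 'M_2) :
  dkron A (\sum_(t <- s) F t) = \sum_(t <- s) dkron A (F t).
Proof. by rewrite (big_morph _ (dkronDr A) (dkronr0 A)). Qed.

Lemma dkron1 n : dkron (1%:M : 'M_(2 ^ n)) 1%:M = 1%:M.
Proof.
apply/matrixP => x y.
have [a [i ->]] := qubit_indexP x; have [b [j ->]] := qubit_indexP y.
rewrite dkronE !mxE -natrM mulnb (inj_eq (@cast_ord_inj _ _ _)).
by rewrite (can_eq (@mxtens_indexK _ _)) xpair_eqE.
Qed.

Lemma strong_prodS rk (Q : forall k, 'M['M[R]_2]_(rk k.-1, rk k)) n :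
  strong_prod Q n.+1 = block_prod (strong_prod Q n) (Q n.+1).
Proof.
apply/matrixP => a b; rewrite /= !mxE.
by apply/matrixP => x y; rewrite castmxE !summxE; apply: eq_bigr => g _;
  rewrite castmxE.
Qed.

Lemma block_prod1 q (Y : 'M['M[R]_2]_(1, q)) :
  block_prod (1%:M : 'M['M[R]_(2 ^ 0)]_1) Y = Y.
Proof.
apply/matrixP => a b; rewrite mxE big_ord1 mxE [a]ord1 mulr1n.
apply/matrixP => x y.
have [u [i ->]] := qubit_indexP x; have [v [j ->]] := qubit_indexP y.
have idx (t : 'I_1) k : qubit_index (n := 0) t k = k.
  by apply: val_inj; rewrite /= [t]ord1.
by rewrite dkronE [u]ord1 [v]ord1 mxE mul1r !idx.
Qed.

Lemma same_block_prod n p q r p' q' r'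
    (X : 'M['M[R]_(2 ^ n)]_(p, q)) (X' : 'M['M[R]_(2 ^ n)]_(p', q'))
    (Y : 'M['M[R]_2]_(q, r)) (Y' : 'M['M[R]_2]_(q', r')) :
  same_mx X X' -> same_mx Y Y' -> same_mx (block_prod X Y) (block_prod X' Y').
Proof.
case=> -[ep eq] <- [[eq' er] <-].
case: _ / ep; case: _ / eq in eq' *; case: _ / er.
(* The inner dimension comes with two equality proofs; the second has become a proof of q = q, which
   is reflexivity on [nat]. *)
by rewrite (eq_axiomK eq') !castmx_id; apply: same_mx_refl.
Qed.

Lemma same_strong_prodS rk (Q : forall k, 'M['M[R]_2]_(rk k.-1, rk k)) n p q r
    (X : 'M['M[R]_(2 ^ n)]_(p, q)) (Y : 'M['M[R]_2]_(q, r)) :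
    same_mx (strong_prod Q n) X -> same_mx (Q n.+1) Y ->
  same_mx (strong_prod Q n.+1) (block_prod X Y).
Proof. by rewrite strong_prodS; apply: same_block_prod. Qed.

(** The 2 x 2 Toeplitz matrix with these values at shifts 0, 1 and -1; every K and M has this
    form. *)
Definition stencil (c0 c1 c_1 : R) : 'M[R]_2 :=
  c0 *: bI R + c1 *: bJ' R + c_1 *: bJ R.

(* [c' d] is the common factor of the three entries of [c] at shifts [2 d],
   [2 d + 1] and [2 d - 1]. *)
Lemma circulant_dkron n (c c' : nat -> R) (m0 m1 m_1 : R) :
    c' 0%N = 0 ->
    (forall d, [/\ c' d.+1 * m0 = c d.*2.+2, c' d.+1 * m1 = c d.*2.+3
               & c' d.+1 * m_1 = c d.*2.+1]) ->
  dkron 1%:M (stencil (c 0%N) (c 1%N) (c (2 ^ n.+1).-1))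
    + dkron (circulant (2 ^ n) c') (stencil m0 m1 m_1)
  = circulant (2 ^ n.+1) c.
Proof.
move=> c'0 c'S; apply/matrixP => x y.
have [a [i ->]] := qubit_indexP x; have [b [j ->]] := qubit_indexP y.
rewrite mxE !dkronE [in LHS]/circulant [in RHS]/circulant !mxE /=.
rewrite expnSr; have := ltn_ord a; have := ltn_ord b; set N := (2 ^ n)%N => bN aN.
have [<-|ab] := eqVneq a b.
  (* In a diagonal block the shift is i - j, and only -1 wraps around, to the last entry of the
     column. *)
  rewrite addKn modnn c'0 mul0r addr0 mul1r.
  case: i => -[|[|//]] li; case: j => -[|[|//]] lj;
    rewrite /= ?(mulr1, mulr0, addr0, add0r); congr (c _).
  - by apply: (@eq_modn_small _ 1); lia.
  - by apply: (@eq_modn_small _ 0); lia.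
  - by apply: (@eq_modn_small _ 1); lia.
  - by apply: (@eq_modn_small _ 1); lia.
rewrite mul0r add0r.
have /(circulant_shift_neq aN bN)[e [d [eE dN]]] : a <> b :> nat.
  by move=> abE; case/eqP: ab; apply: val_inj.
have [h0 h1 h_1] := c'S d.
rewrite -(eq_modn_small eE dN).
(* The quotient [e] of the block shift serves all four entries: 2 (e N + d + 1) + i - j is e (2 N)
   plus 2 d + 1, 2 d + 2 or 2 d + 3. *)
case: i => -[|[|//]] li; case: j => -[|[|//]] lj;
    rewrite /= ?(mulr1, mulr0, addr0, add0r)
      ?(h0, h1, h_1); congr (c _).
all: by apply: (@eq_modn_small _ e); lia.
Qed.

Lemma circulant_sum N r (c : 'I_r -> nat -> R) :
  circulant N (fun j => \sum_t c t j) = \sum_t circulant N (c t).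
Proof.
by apply/matrixP => x y; rewrite summxE mxE; apply: eq_bigr => t _; rewrite mxE.
Qed.

Definition shifted_powers (q : R) (d : nat) : R :=
  if d is d'.+1 then q ^+ d' else 0.

Variables (L r : nat) (alpha w : 'I_r -> R).

Definition partial_qtt (k : nat) : 'M['M[R]_(2 ^ k)]_(1, 1 + r) :=
  row_mx (const_mx 1%:M)
         (\row_t circulant (2 ^ k) (shifted_powers (qnode L w t k))).

Lemma qnodeS t k : (k < L)%N -> qnode L w t k = qnode L w t k.+1 ^+ 2.
Proof. by move=> kL; rewrite /qnode -exprM -expnSr subnSK. Qed.

Lemma bKE t k : bK L w t k = stencil 0 1 (qnode L w t k ^+ (2 ^ k - 2)).
Proof. by rewrite /stencil scale0r add0r scale1r. Qed.

Lemma bME t k :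
  bM L w t k = stencil (qnode L w t k) (qnode L w t k ^+ 2) 1.
Proof. by rewrite /stencil scale1r. Qed.

(** With q = q_(t,k+1), K holds the values at shifts 0, 1 and -1, while (q^2)^d times the
    coefficients q, q^2, 1 of M gives the values at shifts 2 d + 2, 2 d + 3, 2 d + 1. *)
Lemma circulant_shifted_powers t k : (k < L)%N ->
  dkron 1%:M (bK L w t k.+1)
    + dkron (circulant (2 ^ k) (shifted_powers (qnode L w t k)))
            (bM L w t k.+1)
  = circulant (2 ^ k.+1) (shifted_powers (qnode L w t k.+1)).
Proof.
move=> kL; rewrite qnodeS // bKE bME; set q := qnode L w t k.+1.
rewrite -(@circulant_dkron _ _ (shifted_powers (q ^+ 2)) q (q ^+ 2) 1) //.
  congr (dkron _ (stencil _ _ _) + _).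
  have : (1 < 2 ^ k.+1)%N by rewrite -(expn0 2) ltn_exp2l.
  by case: (2 ^ k.+1)%N => [|[|N]] //= _; rewrite subn2.
by move=> d /=; rewrite -exprM -exprSr -exprD mulr1 mul2n -[_.*2.+2]addn2.
Qed.

Lemma partial_qtt_second : (1 < L)%N ->
  block_prod (core_first R : 'M['M[R]_(2 ^ 1)]_(1, 1 + 1)) (core_second L w)
  = partial_qtt 2.
Proof.
move=> L1; apply/matrixP => a b; rewrite mxE big_split_ord /= !big_ord1.
rewrite /core_first /core_second /partial_qtt row_mxEl row_mxEr.
case: (split_ordP b) => t -> {b}.
  rewrite block_mxEul block_mxEdl row_mxEl !mxE dkronr0 addr0.
  exact: dkron1.
rewrite block_mxEur block_mxEdr row_mxEr !mxE -circulant_shifted_powers //.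
(* H is the circulant with first column 0, 1, which is C_(t,1) for every t; so a single column of
   the first core serves all t. *)
congr (_ + dkron _ _).
by apply/matrixP => -[[|[|//]] ?] [[|[|//]] ?]; rewrite !mxE /= ?addr0 ?add0r.
Qed.

Lemma partial_qtt_mid k : (k < L)%N ->
  block_prod (partial_qtt k) (core_mid L w k.+1) = partial_qtt k.+1.
Proof.
move=> kL; apply/matrixP => a b; rewrite mxE big_split_ord /= big_ord1.
rewrite /core_mid /partial_qtt row_mxEl.
case: (split_ordP b) => t -> {b}.
  rewrite block_mxEul row_mxEl !mxE dkron1 big1 ?addr0 // => s _.
  by rewrite block_mxEdl row_mxEr !mxE dkronr0.
rewrite block_mxEur row_mxEr !mxE -circulant_shifted_powers //; congr (_ + _).
rewrite (bigD1 t) //= row_mxEr block_mxEdr !mxE eqxx mulr1n big1 ?addr0 //.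
by move=> s st; rewrite block_mxEdr !mxE (negPf st) mulr0n dkronr0.
Qed.

Lemma block_prod_last k : L = k.+1 ->
  block_prod (partial_qtt k) (core_last L alpha w)
  = const_mx (circulant (2 ^ k.+1) (fun j => \sum_t alpha t * w t ^+ j)).
Proof.
move=> LE; apply/matrixP => a b; rewrite mxE big_split_ord /= big_ord1.
rewrite /core_last /partial_qtt row_mxEl col_mxEu !mxE circulant_sum.
(* The top block of the last core is itself a sum over t, so the identity can be checked for each t
   separately. *)
rewrite !scaler_suml -!big_split /= dkron_sumr -big_split /=.
apply: eq_bigr => t _; rewrite row_mxEr col_mxEd !mxE.
rewrite bME qnodeS ?LE // /qnode subnn expr1 /stencil !scalerDr !scalerA mulr1.
(* Outside the diagonal blocks the shift is at least 1, so alpha_t w_t factors out; what remains is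
   w_t^(2 d) times a coefficient of M_(t,L), whose node is w_t. *)
rewrite -(@circulant_dkron _ _ (shifted_powers (w t ^+ 2))
  (alpha t * w t * w t) (alpha t * w t * w t ^+ 2) (alpha t * w t)) //.
  by rewrite /stencil expr0 expr1 mulr1 subn1.
by move=> d /=; split; rewrite -exprM mul2n !exprS; ring.
Qed.

End Blocks.

Theorem proposition4p1 (R : realType) (L r : nat)
    (hL : (2 < L)%N) (hr : (1 <= r)%N) (alpha w : 'I_r -> R[i]) :
  let ranks : seq nat := 2%N :: nseq (L - 2) r.+1 in
  let B : 'M[R[i]]_(2 ^ L) :=
    circulant (2 ^ L) (fun j => \sum_t alpha t * w t ^+ j) in
  exists Q : forall k : nat,
      'M['M[R[i]]_2]_(qtt_rank ranks k.-1, qtt_rank ranks k),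
    [/\ same_mx (Q 1%N) (core_first R[i]),
        same_mx (Q 2%N) (core_second L w),
        forall k : nat, (3 <= k <= L.-1)%N -> same_mx (Q k) (core_mid L w k),
        same_mx (Q L) (core_last L alpha w)
      & qtt_rep B Q].
Proof.
case: L hL => // l hL ranks B.
set L := l.+1 in hL B *.
have rank_mid k : (1 < k < L)%N -> (1 + r)%N = qtt_rank ranks k.
  case: k => [|[|k]] //= kL.
  by rewrite /qtt_rank /= nth_nseq ifT //; lia.
have rank_last : 1%N = qtt_rank ranks L.
  by rewrite /qtt_rank nth_default //= size_nseq; lia.
(* Only the indices 1 to L matter, and there the dimensions agree, so the default 0 is never
   taken. *)
pose Q k : 'M['M[R[i]]_2]_(qtt_rank ranks k.-1, qtt_rank ranks k) :=
  if k == 1%N then conform_mx 0 (core_first R[i])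
  else if k == 2%N then conform_mx 0 (core_second L w)
  else if k == L then conform_mx 0 (core_last L alpha w)
  else conform_mx 0 (core_mid L w k).
have Q1 : same_mx (Q 1%N) (core_first R[i]) by apply: same_conform_mx.
have Q2 : same_mx (Q 2%N) (core_second L w).
  by apply: same_conform_mx => //; apply: rank_mid.
have Qmid k : (3 <= k <= L.-1)%N -> same_mx (Q k) (core_mid L w k).
  move=> kL; rewrite /Q !ifF; try lia.
  by apply: same_conform_mx; apply: rank_mid; lia.
have QL : same_mx (Q L) (core_last L alpha w).
  rewrite /Q eqxx !ifF; try lia.
  by apply: same_conform_mx => //; apply: rank_mid; lia.
exists Q; split=> //; split; first by rewrite /= size_nseq; lia.
have prod_mid k : (1 < k < L)%N -> same_mx (strong_prod Q k) (partial_qtt L w k).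
  (* The induction starts at 2, since the first core still shares H among all t. *)
  case: k => [|[|k]] //; elim: k => [|k IHk] kL.
    rewrite -partial_qtt_second; last by lia.
    apply: same_strong_prodS Q2.
    rewrite -[core_first _]block_prod1.
    by apply: same_strong_prodS Q1; apply: same_mx_refl.
  rewrite -partial_qtt_mid; last by lia.
  by apply: same_strong_prodS; [apply: IHk | apply: Qmid]; lia.
rewrite -(@block_prod_last _ L _ alpha w l) //.
by apply: same_strong_prodS QL; apply: prod_mid; lia.
Qed.
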